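(* There is an absolute constant $C>0$ such that for every integer $d\ge 2$ and every $d$-dimensional $o$-symmetric convex body $K\subset\mathbb{R}^d$, \[\kappa'(K)\le\kappa(K)\le C\,3^d\,d\log d .\]
   Context: A convex body in $\mathbb{R}^d$ is a compact convex set with non-empty interior; it is $o$-symmetric if $K=-K$. A (positive) homothet of $K$ is a set $\lambda K+v=\{\lambda k+v: k\in K\}$ with $\lambda>0$, $v\in\mathbb{R}^d$; its center is $v$. A Minkowski arrangement of an $o$-symmetric convex body $K$ is a family $\{v_i+\lambda_iK\}$ of positive homothets of $K$ such that no homothet contains the center of another homothet in its interior, i.e. $v_i\notin v_j+\lambda_j\,\mathrm{int}(K)$ for all $i\ne j$. A strict Minkowski arrangement is such a family with $v_i\notin v_j+\lambda_jK$ for all $i\neq j$. A family is pairwise intersecting if any two of its members intersect. $\kappa(K)$ (resp. $\kappa'(K)$) denotes the largest number of homothets in a pairwise intersecting Minkowski arrangement (resp. strict Minkowski arrangement) of $K$. *)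

(* Defs.v *)
From HB Require Import structures.
From mathcomp Require Import all_boot all_order all_algebra.
From mathcomp Require Import all_classical all_reals all_analysis.
From mathcomp Require Import Rstruct Rstruct_topology.
Set Implicit Arguments. Unset Strict Implicit. Unset Printing Implicit Defensive.
Import Order.TTheory GRing.Theory Num.Theory.
Import numFieldNormedType.Exports.
Local Open Scope classical_set_scope.
Local Open Scope ring_scope.

(* Points of R^d are row vectors 'rV[R]_d, with the canonical (product/max-norm)
   topology of MathComp-Analysis. *)

Section Defs.
Variables (R : realType) (d : nat).
Local Notation V := 'rV[R]_d.

Definition convex_set (K : set V) : Prop :=
  forall x y t, K x -> K y -> 0 <= t -> t <= 1 -> K (t *: x + (1 - t) *: y).

Definition convex_body (K : set V) : Prop :=
  compact K /\ convex_set K /\ (interior K !=set0).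

Definition o_symmetric (K : set V) : Prop := [set - x | x in K] = K.

Definition homothet (K : set V) (lam : R) (v : V) : set V :=
  [set v + lam *: k | k in K].

Definition minkowski_arrangement (K : set V) (n : nat)
    (lam : 'I_n -> R) (v : 'I_n -> V) : Prop :=
  (forall i, 0 < lam i) /\
  (forall i j, i != j -> ~ homothet (interior K) (lam j) (v j) (v i)).

Definition strict_minkowski_arrangement (K : set V) (n : nat)
    (lam : 'I_n -> R) (v : 'I_n -> V) : Prop :=
  (forall i, 0 < lam i) /\
  (forall i j, i != j -> ~ homothet K (lam j) (v j) (v i)).

Definition pairwise_intersecting (K : set V) (n : nat)
    (lam : 'I_n -> R) (v : 'I_n -> V) : Prop :=
  forall i j, homothet K (lam i) (v i) `&` homothet K (lam j) (v j) !=set0.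

Definition kappa (K : set V) : \bar R :=
  ereal_sup [set (n%:R)%:E | n in [set n : nat | exists (lam : 'I_n -> R) (v : 'I_n -> V),
     minkowski_arrangement K lam v /\ pairwise_intersecting K lam v]].

Definition kappa' (K : set V) : \bar R :=
  ereal_sup [set (n%:R)%:E | n in [set n : nat | exists (lam : 'I_n -> R) (v : 'I_n -> V),
     strict_minkowski_arrangement K lam v /\ pairwise_intersecting K lam v]].

End Defs.

(* Main.v *)
Require Import Defs.
From HB Require Import structures.
From mathcomp Require Import all_boot all_order all_algebra.
From mathcomp Require Import all_classical all_reals all_analysis.
From mathcomp Require Import Rstruct Rstruct_topology.
From mathcomp Require Import ring lra.
Import Order.TTheory GRing.Theory Num.Theory.
Import numFieldNormedType.Exports.
Local Open Scope classical_set_scope.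
Local Open Scope ring_scope.

(* Let N be the gauge of K, and lam the smallest ratio, attained at a center o.
   The centers of homothets with ratios in [a, (1 + 1/d) a] have mutual
   N-distances in [a, (2 + 2/d) a], and at most e 3^d points can have this
   property.  So d log_2 (4d) geometric scales account for all ratios below
   4 d lam.  For the homothets with larger ratios, the directions
   (v - o) / N(v - o) are unit vectors at mutual distance at least 1 - 1/(2d),
   and the same bound applies to them.
   The bound on n points with mutual distances in [a, D] replaces volume by
   self-similarity: if t (a + D) < a, the points v_(i_1) + t v_(i_2) + ... +
   t^(m-1) v_(i_m) are bounded and separated by a multiple of t^m, so that
   n^m = O(t^(-dm)) and hence n <= t^(-d). *)

(** * Seminorms on R^d, with two elementary real inequalities *)

Definition seminorm {R : realType} {d : nat} (N : 'rV[R]_d -> R) : Prop :=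
  (forall x y, N (x + y) <= N x + N y) /\
  (forall c x, N (c *: x) <= `|c| * N x).

Lemma bernoulli_ineq (R : realType) (x : R) (m : nat) :
  0 <= x -> 1 + m%:R * x <= (1 + x) ^+ m.
Proof.
move=> x0; elim: m => [|m IH]; first by rewrite mul0r addr0 expr0.
rewrite exprS -natr1.
have h : 0 <= m%:R * x * x by rewrite !mulr_ge0.
by apply: le_trans (ler_wpM2l _ IH); lra.
Qed.

(** By Bernoulli, x > 1 would give x^m >= 1 + m (x - 1), which is unbounded in m. This removes the
    constant hidden in n^m = O(t^(-dm)). *)
Lemma le1_of_expr_bounded (R : realType) (x E : R) :
  0 <= x -> (forall m : nat, x ^+ m <= E) -> x <= 1.
Proof.
move=> x0 xE; rewrite leNgt; apply/negP => x1.
have y0 : 0 < x - 1 by lra.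
have := bernoulli_ineq R (x - 1) (Num.truncn (E / (x - 1))).+1 (ltW y0).
have /= := truncnS_gt (E / (x - 1)).
rewrite ltr_pdivrMr // => h1 h2.
have := xE (Num.truncn (E / (x - 1))).+1.
by rewrite (_ : 1 + (x - 1) = x) in h2; [lra|ring].
Qed.

Section Seminorm.
Variables (R : realType) (d : nat) (N : 'rV[R]_d -> R).
Hypothesis snN : seminorm N.

Lemma seminormD x y : N (x + y) <= N x + N y.
Proof. by case: snN. Qed.

Lemma seminorm0 : N 0 = 0.
Proof.
have h1 := snN.2 0 0; have h2 := snN.2 2 0.
have h3 := seminormD 0 0.
move: h1 h2 h3; rewrite !scaler0 addr0 normr0 mul0r ger0_norm //; lra.
Qed.

Lemma seminormZ c x : N (c *: x) = `|c| * N x.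
Proof.
apply/eqP; rewrite eq_le snN.2 /=.
have [->|c0] := eqVneq c 0; first by rewrite scale0r seminorm0 normr0 mul0r.
have := snN.2 c^-1 (c *: x); rewrite scalerA mulVf // scale1r normfV mulrC.
by rewrite ler_pdivlMr ?normr_gt0 // mulrC.
Qed.

Lemma seminormN x : N (- x) = N x.
Proof. by rewrite -scaleN1r seminormZ normrN1 mul1r. Qed.

Lemma seminorm_ge0 x : 0 <= N x.
Proof. by have := seminormD x (- x); rewrite subrr seminorm0 seminormN; lra. Qed.

Lemma seminormB x y : N (x - y) <= N x + N y.
Proof. by rewrite -(seminormN y) seminormD. Qed.

Lemma seminormC x y : N (x - y) = N (y - x).
Proof. by rewrite -seminormN opprB. Qed.

Lemma seminorm_sum (I : finType) (f : I -> 'rV[R]_d) :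
  N (\sum_i f i) <= \sum_i N (f i).
Proof.
elim/big_ind2: _ => //; first by rewrite seminorm0.
by move=> x a y b h1 h2; apply: le_trans (seminormD _ _) (lerD h1 h2).
Qed.

(** Expand x in the standard basis. The summand 1 in the constant keeps it positive, so that it can
    be divided by. *)
Lemma seminorm_le_coord : exists2 B : R, 0 < B &
  forall (x : 'rV[R]_d) s, 0 <= s -> (forall k, `|x 0 k| <= s) -> N x <= B * s.
Proof.
exists (1 + \sum_(k < d) N (delta_mx 0 k)).
  by rewrite ltr_wpDr // sumr_ge0 // => k _; apply: seminorm_ge0.
move=> x s s0 xs; rewrite [x]row_sum_delta; apply: le_trans (seminorm_sum _ _) _.
rewrite mulrDl mul1r ler_wpDl // mulr_suml ler_sum // => k _.
by rewrite seminormZ mulrC ler_wpM2l ?seminorm_ge0.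
Qed.

Lemma seminorm_normalized x : 0 < N x -> N ((N x)^-1 *: x) = 1.
Proof. by move=> x0; rewrite seminormZ normfV gtr0_norm // mulVf ?gt_eqF. Qed.

End Seminorm.

(** * Counting points separated in coordinates *)

Lemma truncn_eq_dist (R : realType) (x y : R) :
  0 <= x -> 0 <= y -> Num.truncn x = Num.truncn y -> `|x - y| < 1.
Proof.
move=> x0 y0 xy; have := truncn_itv x0; have := truncn_itv y0.
by rewrite -xy -natr1 ltr_norml => /andP[? ?] /andP[? ?]; lra.
Qed.

(** Pigeonhole: cut the cube [-A, A]^d into cells of side s. Two points in one cell differ by less
    than s in every coordinate, hence coincide. *)
Lemma card_separated_le (R : realType) (d : nat) (T : finType)
    (g : T -> 'rV[R]_d) (A s : R) :
  0 < s -> 0 <= A -> (forall x k, `|g x 0 k| <= A) ->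
  (forall x y, (forall k, `|g x 0 k - g y 0 k| < s) -> x = y) ->
  #|T|%:R <= (2 * A / s + 1) ^+ d.
Proof.
move=> s0 A0 gA gs.
pose M := Num.truncn (2 * A / s).
pose c x k := (g x 0 k + A) / s.
have c0 x k : 0 <= c x k.
  by rewrite divr_ge0 ?(ltW s0) //; have := gA x k; rewrite ler_norml => /andP[? ?]; lra.
have cM x k : (Num.truncn (c x k) < M.+1)%N.
  rewrite ltnS; apply: le_truncn; rewrite ler_pM2r ?invr_gt0 //.
  by have := gA x k; rewrite ler_norml => /andP[? ?]; lra.
pose h x : {ffun 'I_d -> 'I_M.+1} := [ffun k => Ordinal (cM x k)].
have hinj : injective h.
  move=> x y /ffunP hxy; apply: gs => k.
  have := hxy k; rewrite !ffunE => /(congr1 val) /= /(truncn_eq_dist _ _ _ (c0 x k) (c0 y k)).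
  rewrite /c -mulrBl normrM normfV (gtr0_norm s0) ltr_pdivrMr // mul1r.
  by rewrite (_ : g x 0 k + A - (g y 0 k + A) = g x 0 k - g y 0 k) //; ring.
have /(leq_card _)  := hinj; rewrite card_ffun !card_ord => le.
rewrite -(ler_nat R) natrX in le; apply: le_trans le _.
rewrite lerXn2r ?nnegrE ?addr_ge0 ?divr_ge0 ?mulr_ge0 ?(ltW s0) //.
by rewrite -natr1 lerD2r truncn_le divr_ge0 ?mulr_ge0 ?(ltW s0).
Qed.

(** * Self-similar point sets and the packing bound n <= t^(-d) *)

Section Words.
Variables (R : realType) (d n : nat) (N : 'rV[R]_d -> R) (v : 'I_n -> 'rV[R]_d).
Variables (t a D : R).
Hypotheses (snN : seminorm N) (t0 : 0 < t) (t1 : t < 1).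
Hypothesis vD : forall i j, i != j -> N (v i - v j) <= D.
Hypothesis va : forall i j, i != j -> a <= N (v i - v j).
Hypotheses (D0 : 0 <= D) (taD : t * (a + D) < a).

Fixpoint word_point (w : seq 'I_n) : 'rV[R]_d :=
  if w is i :: w' then v i + t *: word_point w' else 0.

(** [b] solves b = D + t b and bounds the diameter of the words of any fixed length. [c] is the gap
    left between words with different first letters; [taD] makes it positive. *)
Let b := D / (1 - t).
Let c := a - t * b.

Let t1' : 0 < 1 - t. Proof. by rewrite subr_gt0. Qed.

Let bE : D + t * b = b.
Proof. by rewrite /b; field; rewrite gt_eqF. Qed.

Let c_gt0 : 0 < c.
Proof.
have h : c * (1 - t) = a - t * (a + D) by rewrite /c /b; field; rewrite gt_eqF.
by rewrite -(pmulr_lgt0 _ t1') h subr_gt0.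
Qed.

Let word_pointB i w j w' :
  word_point (i :: w) - word_point (j :: w')
  = (v i - v j) + t *: (word_point w - word_point w').
Proof. by rewrite /= scalerBr opprD addrACA. Qed.

Lemma word_point_diam w w' : size w = size w' ->
  N (word_point w - word_point w') <= b.
Proof.
have b0 : 0 <= b by rewrite divr_ge0 // ltW.
elim: w w' => [|i w IH] [|j w'] //=; first by rewrite subrr seminorm0.
move=> [/IH h]; rewrite -/(word_point (i :: w)) -/(word_point (j :: w')) word_pointB.
apply: le_trans (seminormD _ _ _ snN _ _) _; rewrite seminormZ // gtr0_norm // -bE.
apply: lerD; last by rewrite ler_pM2l.
by have [->|/vD//] := eqVneq i j; rewrite subrr seminorm0.
Qed.

(** Each common leading letter costs a factor t. At the first difference the letters contribute at
    least a, and the tails change this by at most t b. *)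
Lemma word_point_separated w w' : size w = size w' -> w != w' ->
  c * t ^+ size w <= N (word_point w - word_point w').
Proof.
elim: w w' => [|i w IH] [|j w'] //= [sz].
rewrite eqseq_cons -/(word_point (i :: w)) -/(word_point (j :: w')) word_pointB.
have [-> /= ww'|ij _] := eqVneq i j.
  rewrite subrr add0r seminormZ // gtr0_norm // exprS mulrCA ler_pM2l //.
  exact: IH.
have h1 := word_point_diam _ _ sz; have h2 := va _ _ ij.
have := seminormB _ _ _ snN (v i - v j + t *: (word_point w - word_point w'))
  (t *: (word_point w - word_point w')).
rewrite addrK seminormZ // gtr0_norm // => h3.
have h4 : t * N (word_point w - word_point w') <= t * b by rewrite ler_pM2l.
have h5 : c * t ^+ (size w).+1 <= c * 1.
  by rewrite ler_pM2l // exprn_ile1 ?(ltW t0) ?(ltW t1).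
by move: h5; rewrite mulr1 /c; lra.
Qed.

Lemma word_point_bounded : exists2 A : R, 0 <= A &
  forall w k, `|word_point w 0 k| <= A.
Proof.
pose E := \sum_i \sum_k `|v i 0 k|.
have E0 : 0 <= E by rewrite sumr_ge0 // => i _; rewrite sumr_ge0.
have vE i k : `|v i 0 k| <= E.
  rewrite /E (bigD1 i) //= (bigD1 k) //= -addrA lerDl addr_ge0 ?sumr_ge0 // => j _.
  by rewrite sumr_ge0.
exists (E / (1 - t)); first by rewrite divr_ge0 // ltW.
elim=> [|i w IH] k /=; first by rewrite mxE normr0 divr_ge0 // ltW.
rewrite !mxE; apply: le_trans (ler_normD _ _) _.
have -> : E / (1 - t) = E + t * (E / (1 - t)) by field; rewrite gt_eqF.
by rewrite lerD // normrM gtr0_norm // ler_pM2l.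
Qed.

Lemma card_le_of_separated_ord : n%:R * t ^+ d <= 1.
Proof.
have [B B0 NB] := seminorm_le_coord _ _ _ snN.
have [A A0 wA] := word_point_bounded.
(* The bound on (n t^d)^m must not depend on m: multiplying 2 A / s + 1 by t^m, with the [s] below,
   gives 2 A * 2 B / c + t^m, and t^m <= 1. *)
apply: (@le1_of_expr_bounded R _ ((2 * A * 2 * B / c + 1) ^+ d)).
  by rewrite mulr_ge0 // exprn_ge0 // ltW.
(* Points closer than s in every coordinate have N-distance at most B s = c t^m / 2, below the
   separation of words of length m. *)
move=> m; pose s := c * t ^+ m / (2 * B).
have tm : 0 < t ^+ m by rewrite exprn_gt0.
have s0 : 0 < s by rewrite divr_gt0 ?mulr_gt0.
have sep (x y : m.-tuple 'I_n) :
    (forall k, `|word_point x 0 k - word_point y 0 k| < s) -> x = y.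
  move=> xy; apply/eqP/negPn/negP => nxy.
  have := @word_point_separated x y; rewrite !size_tuple => /(_ erefl nxy).
  have h k : `|(word_point x - word_point y) 0 k| <= s.
    by have := xy k; rewrite !mxE => /ltW.
  have := NB _ s (ltW s0) h.
  have -> : B * s = c * t ^+ m / 2 by rewrite /s; field; rewrite gt_eqF.
  have : 0 < c * t ^+ m by rewrite mulr_gt0.
  lra.
have := card_separated_le _ _ _ _ A s s0 A0 (fun w => wA (tval w)) sep.
rewrite card_tuple card_ord natrX => h.
have {h} : n%:R ^+ m * (t ^+ m) ^+ d <= ((2 * A / s + 1) * t ^+ m) ^+ d.
  by rewrite exprMn ler_pM2r // exprn_gt0.
rewrite -exprM mulnC exprM -exprMn => h; apply: le_trans h _.
have p0 : 0 <= (2 * A / s + 1) * t ^+ m.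
  apply: mulr_ge0 (ltW tm); apply: addr_ge0 => //.
  by apply: divr_ge0 (ltW s0); apply: mulr_ge0.
have q0 : 0 <= 2 * A * 2 * B / c.
  by rewrite divr_ge0 ?(ltW c_gt0) // !mulr_ge0 // ltW.
rewrite lerXn2r ?nnegrE ?addr_ge0 //.
have -> : (2 * A / s + 1) * t ^+ m = 2 * A * 2 * B / c + t ^+ m.
  by rewrite /s; field; rewrite !gt_eqF.
by rewrite lerD2l exprn_ile1 // ltW.
Qed.

End Words.

(** * The bound e 3^d for nearly equidistant points *)

Lemma card_le_of_separated (R : realType) (d : nat) (N : 'rV[R]_d -> R)
    (I : finType) (S : {set I}) (v : I -> 'rV[R]_d) (t a D : R) :
  seminorm N -> 0 < t -> t < 1 -> 0 <= D -> t * (a + D) < a ->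
  {in S &, forall i j, i != j -> a <= N (v i - v j) <= D} ->
  #|S|%:R * t ^+ d <= 1.
Proof.
move=> snN t0 t1 D0 taD vS.
have vS' (i j : 'I_#|S|) : i != j ->
    a <= N (v (enum_val i) - v (enum_val j)) <= D.
  by move=> ij; apply: vS; rewrite ?enum_valP // (inj_eq enum_val_inj).
apply: (@card_le_of_separated_ord R d _ N (fun i => v (enum_val i)) t a D) => //.
- by move=> i j /vS' /andP[].
- by move=> i j /vS' /andP[].
Qed.

(** Take t = 1 / (3 (1 + 1/d)): then t (a + D) = t a (3 + 2/d) < a, and t^(-d) = 3^d (1 + 1/d)^d <=
    e 3^d. *)
Lemma card_le_exp1_3d (R : realType) (d : nat) (N : 'rV[R]_d -> R)
    (I : finType) (S : {set I}) (v : I -> 'rV[R]_d) (a : R) :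
  (0 < d)%N -> seminorm N -> 0 < a ->
  {in S &, forall i j, i != j -> a <= N (v i - v j) <= (2 + 2 / d%:R) * a} ->
  #|S|%:R <= expR 1 * 3 ^+ d :> R.
Proof.
move=> d0 snN a0 vS; have dR : 0 < d%:R :> R by rewrite ltr0n.
have dV : 0 < d%:R^-1 :> R by rewrite invr_gt0.
pose q : R := 1 + d%:R^-1; have q0 : 0 < q by rewrite /q; lra.
pose t := (3 * q)^-1; have t0 : 0 < t by rewrite invr_gt0 mulr_gt0.
have t1 : t < 1 by rewrite invf_lt1 ?mulr_gt0 // /q; lra.
have tq : t * (3 * q) = 1 by rewrite mulVf // mulf_neq0 // gt_eqF.
have h : #|S|%:R * t ^+ d <= 1.
  apply: (@card_le_of_separated R d N I S v t a ((2 + 2 / d%:R) * a)) => //.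
    by rewrite mulr_ge0 ?(ltW a0) // addr_ge0 // divr_ge0 // ltW.
  have -> : t * (a + (2 + 2 / d%:R) * a) = t * (3 * q) * a - t * (d%:R^-1 * a).
    by rewrite /q; ring.
  by rewrite tq mul1r ltrBlDr ltrDl mulr_gt0 // mulr_gt0.
have qe : q ^+ d <= expR 1.
  have -> : expR 1 = expR (d%:R^-1 : R) ^+ d.
    by rewrite -expRM_natl mulfV // gt_eqF.
  by rewrite lerXn2r ?nnegrE ?expR_ge0 ?(ltW q0) // expR_ge1Dx.
have td : t ^+ d * (3 * q) ^+ d = 1 by rewrite -exprMn tq expr1n.
have q3 : 0 <= (3 * q) ^+ d by rewrite exprn_ge0 // mulr_ge0 // ltW.
have := ler_wpM2r q3 h.
rewrite -mulrA td mulr1 mul1r => /le_trans; apply.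
by rewrite exprMn mulrC ler_wpM2r // exprn_ge0.
Qed.

(** With unit directions u, w one has x - y = N(y) (u - w) + (N(x) - N(y)) u. It serves to bound N(u
    - w) from below when x - y is long and the lengths are close. *)
Lemma dist_normalized (R : realType) (d : nat) (N : 'rV[R]_d -> R) (x y : 'rV[R]_d) :
  seminorm N -> 0 < N x -> 0 < N y ->
  N (x - y) <= N y * N ((N x)^-1 *: x - (N y)^-1 *: y) + `|N x - N y|.
Proof.
move=> snN x0 y0; set u := _ *: x; set w := _ *: y.
have -> : x - y = N y *: (u - w) + (N x - N y) *: u.
  rewrite scalerBr scalerBl !scalerA !mulfV ?gt_eqF // !scale1r.
  by rewrite [RHS]addrC addrA subrK.
apply: le_trans (seminormD _ _ _ snN _ _) _; rewrite (seminormZ _ _ _ snN (N y)) (seminormZ _ _ _ snN (N x - N y)).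
by rewrite seminorm_normalized // mulr1 gtr0_norm.
Qed.

(** * Counting homothets through the distances between centers *)

Section Arrangement.
Variables (R : realType) (d n : nat) (N : 'rV[R]_d -> R).
Variables (lam : 'I_n -> R) (v : 'I_n -> 'rV[R]_d).
Hypotheses (snN : seminorm N) (d0 : (0 < d)%N).
Hypothesis lam0 : forall i, 0 < lam i.
Hypothesis lam_le : forall i j, i != j -> lam j <= N (v i - v j).
Hypothesis le_lam : forall i j, N (v i - v j) <= lam i + lam j.

Let M : R := expR 1 * 3 ^+ d.
Let q : R := 1 + d%:R^-1.
Let dR : 0 < d%:R :> R. Proof. by rewrite ltr0n. Qed.
Let dV : 0 < d%:R^-1 :> R. Proof. by rewrite invr_gt0. Qed.

Lemma card_scale_class (a : R) : 0 < a ->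
  #|[set i | a <= lam i < a * q]%SET|%:R <= M.
Proof.
move=> a0; apply: (@card_le_exp1_3d R d N _ _ v a) => // i j.
rewrite !inE => /andP[ai iq] /andP[aj jq] ij.
rewrite (le_trans aj (lam_le _ _ ij)) /=; apply: le_trans (le_lam _ _) _.
by move: iq jq; rewrite /q; lra.
Qed.

Lemma card_scale_lt (m : R) k : 0 < m -> (forall i, m <= lam i) ->
  #|[set i | lam i < m * q ^+ k]%SET|%:R <= k%:R * M.
Proof.
move=> m0 mlam; elim: k => [|k IH].
  rewrite (_ : [set i | _]%SET = finset.set0) ?cards0 ?mul0r //.
  by apply/setP => i; rewrite !inE expr0 mulr1 ltNge mlam.
have mq : 0 < m * q ^+ k by rewrite mulr_gt0 // exprn_gt0 // addr_gt0.
have sub : [set i | lam i < m * q ^+ k.+1]%SET \subset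
    [set i | lam i < m * q ^+ k]%SET :|: [set i | m * q ^+ k <= lam i < m * q ^+ k * q]%SET.
  apply/fintype.subsetP => i; rewrite !inE exprSr mulrA => ->.
  by rewrite andbT leNgt; case: (_ < _).
have := leq_trans (subset_leq_card sub) (leq_card_setU _ _).
rewrite -(ler_nat R) natrD -natr1 mulrDl mul1r => /le_trans; apply.
by rewrite lerD // card_scale_class.
Qed.

(** Write m for the least ratio. Each N(x_i) lies in [lam_i, lam_i + m]. If lam_j <= lam_i, then
    N(v_i - v_j) >= lam_i, so [dist_normalized] gives (lam_j + m) N(u_i - u_j) >= lam_j - m, where
    lam_i has cancelled. *)
Lemma card_scale_large i0 : (forall i, lam i0 <= lam i) ->
  #|[set i | 4 * d%:R * lam i0 <= lam i]%SET|%:R <= M.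
Proof.
move=> i0min; pose x i := v i - v i0.
have d1 : 1 <= d%:R :> R by rewrite ler1n.
have big i : 4 * d%:R * lam i0 <= lam i -> i != i0.
  move=> h; apply/eqP => ii; move: h (lam0 i0); rewrite ii => h l0.
  by have := ler_wpM2r (ltW l0) d1; lra.
have xlam i : i != i0 -> 0 < N (x i).
  by rewrite eq_sym => /lam_le h; rewrite /x seminormC //; apply: lt_le_trans h.
pose u i := (N (x i))^-1 *: x i.
pose a : R := 1 - (2 * d%:R)^-1.
have aE : a = 1 - d%:R^-1 / 2 by rewrite /a invfM mulrC.
have dV1 : d%:R^-1 <= 1 :> R by rewrite invf_le1.
have sep i j : i != j -> 4 * d%:R * lam i0 <= lam i -> 4 * d%:R * lam i0 <= lam j ->
    lam j <= lam i -> a <= N (u i - u j).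
  move=> ij li lj ji; have /xlam xi := big _ li; have /xlam xj := big _ lj.
  have := dist_normalized _ _ _ (x i) (x j) snN xi xj.
  rewrite -/(u i) -/(u j) (_ : x i - x j = v i - v j); last first.
    by rewrite /x opprB addrA subrK.
  have h1 : lam i <= N (v i - v j) by rewrite seminormC // lam_le // eq_sym.
  have hi1 := le_lam i i0; have hj1 := le_lam j i0.
  have hi2 : lam i <= N (x i).
    by rewrite /x seminormC // lam_le // eq_sym big.
  have hj2 : lam j <= N (x j).
    by rewrite /x seminormC // lam_le // eq_sym big.
  rewrite -/(x i) -/(x j) in hi1 hj1.
  have h2 : `|N (x i) - N (x j)| <= lam i + lam i0 - lam j.
    by rewrite ler_norml; lra.
  have u0 := seminorm_ge0 _ _ _ snN (u i - u j).
  have h3 : N (x j) * N (u i - u j) <= (lam j + lam i0) * N (u i - u j).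
    by rewrite ler_wpM2r.
  move=> h4; have h5 : lam j - lam i0 <= (lam j + lam i0) * N (u i - u j) by lra.
  have p0 : 0 < lam j + lam i0 by rewrite addr_gt0.
  rewrite -(ler_pM2l p0); apply: le_trans h5; rewrite aE.
  (* The loss 2 m is at most lam_j / (2d), because lam_j >= 4 d m. *)
  have : d%:R^-1 * (4 * d%:R * lam i0) <= d%:R^-1 * lam j by rewrite ler_pM2l.
  have -> : d%:R^-1 * (4 * d%:R * lam i0) = 4 * lam i0 by field; rewrite gt_eqF.
  have := mulr_gt0 dV (lam0 i0); lra.
apply: (@card_le_exp1_3d R d N _ _ u a) => //; first by rewrite aE; lra.
move=> i j; rewrite !inE => li lj ij; apply/andP; split.
  have [ji|/ltW ij'] := leP (lam j) (lam i); first exact: sep.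
  by rewrite seminormC //; apply: sep; rewrite // eq_sym.
have Nu k : 4 * d%:R * lam i0 <= lam k -> N (u k) = 1.
  by move=> /big /xlam; apply: seminorm_normalized.
(* Unit vectors are at most 2 apart, and (2 + 2/d)(1 - 1/(2d)) = 2 + 1/d - 1/d^2 >= 2. *)
apply: le_trans (seminormB _ _ _ snN _ _) _; rewrite !Nu //.
rewrite aE; have : d%:R^-1 * d%:R^-1 <= d%:R^-1 :> R by rewrite ler_piMr // ltW.
lra.
Qed.

(** Bernoulli gives q^d >= 2, so d L geometric classes reach q^(dL) >= 2^L >= 4d times the least
    ratio; one further class holds the large homothets. *)
Lemma card_arrangement (L : nat) : (4 * d <= 2 ^ L)%N ->
  n%:R <= (1 + (d * L)%:R) * M.
Proof.
move=> dL; have M0 : 0 <= M by rewrite /M mulr_ge0 ?expR_ge0 ?exprn_ge0.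
have [n0|n0] := posnP n.
  by rewrite [X in X%:R]n0 mulr_ge0 // addr_ge0.
pose i0 := [arg min_(i < Ordinal n0) lam i]%O.
have i0min i : lam i0 <= lam i.
  by rewrite /i0; case: Order.TotalTheory.arg_minP => // j _; apply.
have qd : 2 <= q ^+ d.
  have := bernoulli_ineq R d%:R^-1 d (ltW dV).
  by rewrite mulfV ?gt_eqF.
have qL : 4 * d%:R <= q ^+ (d * L).
  rewrite exprM -natrM; apply: le_trans (_ : 2 ^+ L <= _).
    by rewrite -natrX ler_nat.
  by rewrite lerXn2r ?nnegrE // exprn_ge0 // addr_ge0 // ltW.
have sub : [set: 'I_n]%SET \subset [set i | lam i < lam i0 * q ^+ (d * L)]%SET
    :|: [set i | 4 * d%:R * lam i0 <= lam i]%SET.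
  apply/fintype.subsetP => i _; rewrite !inE; case: ltP => //= h.
  by apply: le_trans h; rewrite mulrC ler_pM2l.
have := leq_trans (subset_leq_card sub) (leq_card_setU _ _).
rewrite cardsT card_ord -(ler_nat R) natrD => /le_trans; apply.
have -> : (1 + (d * L)%:R) * M = (d * L)%:R * M + M by ring.
by apply: lerD; [apply: card_scale_lt|apply: card_scale_large].
Qed.

End Arrangement.

(** * The gauge of a symmetric convex body *)

Section Gauge.
Variables (R : realType) (d : nat) (K : set 'rV[R]_d).
Hypotheses (Kc : Defs.convex_set K) (K0 : interior K !=set0) (Ks : o_symmetric K).

Lemma interior_normP (x : 'rV[R]_d) :
  interior K x <-> exists2 e, 0 < e & forall y, `|x - y| < e -> K y.
Proof. exact: (@nbhs_normP R 'rV[R]_d x K). Qed.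

Lemma symmetricN x : K x -> K (- x).
Proof. by move=> Kx; rewrite -Ks; exists x. Qed.

(** y is the midpoint of x0 + 2y and -x0, where x0 is an interior point of K. *)
Lemma ball0_subset : exists2 e, 0 < e & forall y : 'rV[R]_d, `|y| < e -> K y.
Proof.
have [x0 /[dup] /interior_subset Kx0 /interior_normP[e e0 xK]] := K0.
exists (e / 2) => [|y ye]; first by rewrite divr_gt0.
have Kz : K (x0 + 2 *: y).
  by apply: xK; rewrite opprD addNKr normrN normrZ ger0_norm //; lra.
have := Kc _ _ 2^-1 Kz (symmetricN _ Kx0).
have -> : 1 - 2^-1 = 2^-1 :> R by lra.
rewrite -scalerDr addrAC subrr add0r scalerA mulVf // scale1r; apply; lra.
Qed.

(** Any y near s k is s k + (1 - s) z with z = (y - s k) / (1 - s) in a ball about 0 inside K. *)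
Lemma interior_scale (s : R) k : 0 <= s -> s < 1 -> K k -> interior K (s *: k).
Proof.
move=> s0 s1 Kk; have [e e0 eK] := ball0_subset.
have s1' : 0 < 1 - s by lra.
apply/interior_normP; exists ((1 - s) * e) => [|y ye]; first by rewrite mulr_gt0.
have Kz : K ((1 - s)^-1 *: (y - s *: k)).
  apply: eK; rewrite normrZ distrC normfV gtr0_norm // mulrC ltr_pdivrMr //.
  by rewrite mulrC.
have := Kc _ _ s Kk Kz s0 (ltW s1).
by rewrite scalerA mulfV ?gt_eqF // scale1r addrC subrK.
Qed.

Definition gauge (x : 'rV[R]_d) : R := inf [set r : R | 0 < r /\ K (r^-1 *: x)].

Lemma gauge_nonempty x : [set r : R | 0 < r /\ K (r^-1 *: x)] !=set0.
Proof.
have [e e0 eK] := ball0_subset.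
have r0 : 0 < (`|x| + 1) / e by rewrite divr_gt0 // ltr_wpDl.
exists ((`|x| + 1) / e); split => //; apply: eK.
rewrite normrZ normfV gtr0_norm // invf_div mulrAC ltr_pdivrMr ?ltr_wpDl //.
by rewrite ltr_pM2l // ltrDl.
Qed.

Lemma gauge_le x r : 0 < r -> K (r^-1 *: x) -> gauge x <= r.
Proof. by move=> r0 xr; apply: ge_inf => //; exists 0 => s [/ltW]. Qed.

Lemma gauge_lt x s : gauge x < s -> exists r, [/\ 0 < r, r < s & K (r^-1 *: x)].
Proof. by move=> /(inf_lt (gauge_nonempty x)) [r [? ?] ?]; exists r. Qed.

Lemma gauge_leP x y c : 0 <= c ->
  (forall r, 0 < r -> K (r^-1 *: x) -> gauge y <= c * r) -> gauge y <= c * gauge x.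
Proof.
move=> c0 h; apply/ler_addgt0Pr => e e0.
have c1 : 0 < c + 1 by lra.
(* The slack is divided by c + 1 rather than c to allow c = 0. *)
have : gauge x < gauge x + e / (c + 1) by rewrite ltrDl divr_gt0.
move=> /gauge_lt[r [r0 rx /(h _ r0)]] /le_trans; apply.
apply: le_trans (ler_wpM2l c0 (ltW rx)) _; rewrite mulrDr lerD2l.
by rewrite mulrA ler_pdivrMr // mulrC ler_pM2l //; lra.
Qed.

(** A convex combination of x / r and y / s with weights r / (r + s) and s / (r + s). Both the
    triangle inequality and the bound for intersecting homothets rest on it. *)
Lemma convex_scaleD x y r s : 0 < r -> 0 < s -> K (r^-1 *: x) -> K (s^-1 *: y) ->
  K ((r + s)^-1 *: (x + y)).
Proof.
move=> r0 s0 Kx Ky; have rs : 0 < r + s by rewrite addr_gt0.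
have h0 : 0 <= r / (r + s) by rewrite divr_ge0 // ltW.
have h1 : r / (r + s) <= 1 by rewrite ler_pdivrMr //; lra.
have := Kc _ _ _ Kx Ky h0 h1; rewrite !scalerA.
have -> : r / (r + s) * r^-1 = (r + s)^-1 by field; rewrite !gt_eqF.
have -> : (1 - r / (r + s)) * s^-1 = (r + s)^-1 by field; rewrite !gt_eqF.
by rewrite scalerDr.
Qed.

Lemma gauge_seminorm : seminorm gauge.
Proof.
split=> [x y|c x].
  apply/ler_addgt0Pr => e e0.
  have /gauge_lt[r [r0 rx Kr]] : gauge x < gauge x + e / 2 by rewrite ltrDl divr_gt0.
  have /gauge_lt[s [s0 sy Ks']] : gauge y < gauge y + e / 2 by rewrite ltrDl divr_gt0.
  by have := gauge_le _ _ (addr_gt0 r0 s0) (convex_scaleD _ _ _ _ r0 s0 Kr Ks'); lra.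
apply: gauge_leP => // r r0 Kr.
(* For c = 0 the radius |c| r is not positive, so the gauge of 0 is compared with every s > 0
   instead. *)
have [->|c0] := eqVneq c 0.
  have [e e0 eK] := ball0_subset.
  rewrite scale0r normr0 mul0r; apply/ler_addgt0Pr => s s0; rewrite add0r.
  by apply: gauge_le => //; rewrite scaler0; apply: eK; rewrite normr0.
apply: gauge_le; first by rewrite mulr_gt0 // normr_gt0.
rewrite scalerA invfM mulrAC -normfV.
have [c1|c1] := ger0P c^-1.
  by rewrite mulVf // mul1r.
by rewrite mulNr mulVf // mulN1r scaleNr; apply: symmetricN.
Qed.

(** Otherwise (x - y) / l would be a point of K shrunk by a factor r / l < 1, hence interior. *)
Lemma gauge_ge_of_notin_interior l (x y : 'rV[R]_d) : 0 < l ->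
  ~ homothet (interior K) l y x -> l <= gauge (x - y).
Proof.
move=> l0 nx; rewrite leNgt; apply/negP => /gauge_lt[r [r0 rl Kr]]; apply: nx.
exists (l^-1 *: (x - y)); last by rewrite scalerA mulfV ?gt_eqF // scale1r addrC subrK.
have -> : l^-1 *: (x - y) = (r / l) *: (r^-1 *: (x - y)).
  by rewrite scalerA mulrAC mulfV ?gt_eqF // mul1r.
apply: interior_scale => //; first by rewrite divr_ge0 // ltW.
by rewrite ltr_pdivrMr // mul1r.
Qed.

Lemma gauge_le_of_intersect l m (x y : 'rV[R]_d) : 0 < l -> 0 < m ->
  homothet K l x `&` homothet K m y !=set0 -> gauge (x - y) <= l + m.
Proof.
move=> l0 m0 [_ [[k Kk <-] [k' Kk' /esym e]]].
have -> : x - y = m *: k' + l *: - k.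
  by rewrite -[x](addrK (l *: k)) e [y + _]addrC addrAC addrK scalerN.
apply: gauge_le; first by rewrite addr_gt0.
rewrite [l + m]addrC; apply: convex_scaleD => //; rewrite scalerA mulVf ?gt_eqF // scale1r //.
exact: symmetricN.
Qed.

End Gauge.

(** * Choice of the constant and conclusion *)

Lemma trunc_log2_le_ln (R : realType) (d : nat) : (0 < d)%N ->
  (trunc_log 2 d)%:R * ln 2 <= ln d%:R :> R.
Proof.
move=> d0; rewrite mulr_natl -lnXn // ler_ln ?posrE ?exprn_gt0 ?ltr0n //.
by rewrite -natrX ler_nat trunc_logP.
Qed.

Theorem theorem1 :
  exists C : Rdefinitions.R, 0 < C /\
    forall (d : nat) (K : set 'rV[Rdefinitions.R]_d),
      (2 <= d)%N -> convex_body K -> o_symmetric K ->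
      (kappa' K <= kappa K)%E /\
      (kappa K <= (C * 3 ^+ d * d%:R * ln (d%:R : Rdefinitions.R))%:E)%E.
Proof.
have ln2 : 0 < ln 2 :> Rdefinitions.R by rewrite ln_gt0 // ltr1n.
(* The count is at most (1 + d L) e 3^d, with 1 + d L <= 2 d L and L <= 4 ln d / ln 2. *)
exists (8 * expR 1 / ln 2); split; first by rewrite divr_gt0 // mulr_gt0 ?expR_gt0.
move=> d K d2 [_ [Kc K0]] Ks; split.
  (* A strict arrangement is an arrangement, as the interior lies in K. *)
  apply: ereal_sup_le => _ [n [lam [v [[l0 h] pi]]] <-]; exists n => //.
  exists lam, v; split=> //; split=> // i j /h nh [k /interior_subset Kk e].
  by apply: nh; exists k.
apply: ge_ereal_sup => _ [n [lam [v [[l0 h] pi]]] <-]; rewrite lee_fin.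
have d0 : (0 < d)%N by apply: ltn_trans d2.
(* 2^2 supplies the factor 4, and d < 2^([trunc_log 2 d] + 1) the factor d. *)
pose L := (2 + (trunc_log 2 d).+1)%N.
have dL : (4 * d <= 2 ^ L)%N.
  rewrite /L expnD leq_mul2l /=.
  by rewrite ltnW // trunc_log_ltn.
have snK := gauge_seminorm _ _ _ Kc K0 Ks.
have := @card_arrangement _ d n (gauge _ _ K) lam v snK d0 l0 _ _ L dL.
have hl i j : i != j -> lam j <= gauge _ _ K (v i - v j).
  by move=> /h; apply: gauge_ge_of_notin_interior.
have hg i j : gauge _ _ K (v i - v j) <= lam i + lam j.
  exact: gauge_le_of_intersect (pi i j).
move=> /(_ hl hg) /le_trans; apply.
have lnd : ln 2 <= ln d%:R :> Rdefinitions.R by rewrite ler_ln ?posrE ?ltr0n // ler_nat.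
(* L is 3 plus [trunc_log 2 d], and d >= 2 gives 3 ln 2 <= 3 ln d. *)
have L4 : L%:R * ln 2 <= 4 * ln d%:R :> Rdefinitions.R.
  rewrite /L -addSnnS natrD mulrDl.
  by have := trunc_log2_le_ln Rdefinitions.R d d0; lra.
have dL1 : 1 + (d * L)%:R <= 2 * (d%:R * L%:R) :> Rdefinitions.R.
  rewrite natrM.
  have : 1 <= d%:R * L%:R :> Rdefinitions.R by rewrite -natrM ler1n muln_gt0 d0.
  lra.
have dL2 : 2 * (d%:R * L%:R) <= 8 * d%:R * ln d%:R / ln 2 :> Rdefinitions.R.
  rewrite ler_pdivlMr //.
  have := ler_wpM2l (ler0n Rdefinitions.R d) L4; lra.
have M0 : 0 <= expR 1 * 3 ^+ d :> Rdefinitions.R by rewrite mulr_ge0 ?expR_ge0 ?exprn_ge0.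
apply: le_trans (ler_wpM2r M0 (le_trans dL1 dL2)) _.
by rewrite le_eqVlt; apply/orP; left; apply/eqP; field; rewrite gt_eqF.
Qed.
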